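(* Let $G=(V,\boldsymbol{W})$ be a weighted directed network with normalized weight matrix $\boldsymbol{P}$ and node classification $\mathcal{C}=\{R_1,\dots,R_K,T,D\}$. For each nonempty $S\in\mathcal{C}$, consider the bi-objective optimization problem in the unknowns $(\boldsymbol{x}_S^{\top},\delta_S,\beta_S)$, with $\boldsymbol{x}_S\in\mathbb{R}^{|S|}$ a column vector and $\delta_S,\beta_S\in\mathbb{R}$: $$ \begin{array}{ll} \text{Minimize} & (\delta_S,\beta_S)\\ \text{subject to} & \boldsymbol{x}_S^{\top}=(1-\delta_S)\,\boldsymbol{x}_S^{\top}\boldsymbol{P}_S+\beta_S\boldsymbol{e}_S^{\top},\\ & \boldsymbol{x}_S^{\top}\boldsymbol{e}_S=1,\\ & \boldsymbol{x}_S\ge \boldsymbol{0},\\ & 0\le\delta_S\le 1,\quad \beta_S\ge 0 . \end{array} $$ Then, for each nonempty $S\in\mathcal{C}$, this problem admits a unique optimal solution, namely $(\boldsymbol{x}_S^{\top},\delta_S,\beta_S)=(\boldsymbol{\lambda}_S,0,\beta_S^* )$. Moreover, this optimal solution is independent of whether $\delta_S$ or $\beta_S$ is minimized first, because both orders select the same solution. Here $$ \beta_S^*=\begin{cases} 1/|D|, & S=D,\\ 0, & S\in\{R_1,\dots,R_K\},\\ \dfrac{1}{\boldsymbol{e}_T^{\top}(\boldsymbol{I}-\boldsymbol{P}_T)^{-1}\boldsymbol{e}_T}, & S=T,\end{cases} $$ and $$ \boldsymbol{\lambda}_D=\frac{\boldsymbol{e}_D^{\top}}{|D|},\qquad \boldsymbol{\lambda}_T=\frac{\boldsymbol{e}_T^{\top}(\boldsymbol{I}-\boldsymbol{P}_T)^{-1}}{\boldsymbol{e}_T^{\top}(\boldsymbol{I}-\boldsymbol{P}_T)^{-1}\boldsymbol{e}_T},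 $$ and, for $k=1,\dots,K$, $\boldsymbol{\lambda}_{R_k}$ is the unique stationary distribution (row) vector of $\boldsymbol{P}_{R_k}$, i.e. $\boldsymbol{\lambda}_{R_k}\boldsymbol{P}_{R_k}=\boldsymbol{\lambda}_{R_k}$, $\boldsymbol{\lambda}_{R_k}\boldsymbol{e}_{R_k}=1$, $\boldsymbol{\lambda}_{R_k}\ge\boldsymbol{0}^{\top}$.
   Context: Network: $V=\{1,\dots,N\}$ is the node set, $\boldsymbol{W}=(w_{i,j})_{i,j\in V}$ is a matrix with nonnegative real entries, where $w_{i,j}$ is the weight of the directed link from $i$ to $j$ ($0$ means no link). Let $w_i^{out}=\sum_{j\in V}w_{i,j}$. The normalized weight matrix $\boldsymbol{P}=(p_{i,j})_{i,j\in V}$ has $p_{i,j}=w_{i,j}/w_i^{out}$ if $w_i^{out}>0$ and $p_{i,j}=0$ if $w_i^{out}=0$. For $S\subseteq V$, $\boldsymbol{P}_S=(p_{i,j})_{i,j\in S}$. Node classification: $D=\{i\in V: w_i^{out}=0\}$ (dangling class). A nonempty set $S\subseteq V\setminus D$ is a recurrent class if it is a closed strongly connected component of $G$, i.e. $\sum_{n\ge1}[\boldsymbol{W}^n]_{i,j}>0$ for all $i,j\in S$ and $\sum_{n\ge1}[\boldsymbol{W}^n]_{i,j}=0$ for all $i\in S$, $j\in V\setminus S$. The recurrent classes are $R_1,\dots,R_K$ ($K\ge0$), which are pairwise disjoint; $R=\bigsqcup_k R_k$. The transient class is $T=V\setminus(R\sqcup D)$. $\mathcal{C}=\{R_1,\dots,R_K,T,D\}$;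 some of the classes may be empty. Each $\boldsymbol{P}_{R_k}$ is an irreducible stochastic matrix, $\boldsymbol{P}_D=\boldsymbol{O}$, and, when $T\ne\varnothing$, $\boldsymbol{I}-\boldsymbol{P}_T$ is invertible with $(\boldsymbol{I}-\boldsymbol{P}_T)^{-1}=\sum_{n\ge0}(\boldsymbol{P}_T)^n$. Conventions: $\boldsymbol{e}_S$ is the column vector of ones indexed by $S$; Greek bold letters denote row vectors; $\boldsymbol{I}$ is the identity matrix. Optimality for the bi-objective problem is lexicographic: minimize one of the two objectives $\delta_S,\beta_S$ over all feasible triples, then minimize the other one among the minimizers of the first; the claim is that either order yields exactly the one stated triple. *)

(* Defs.v *)
From HB Require Import structures.
From mathcomp Require Import all_boot all_order all_algebra.
From mathcomp Require Import boolp classical_sets reals ereal topology normedtype sequences.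

Set Implicit Arguments.
Unset Strict Implicit.
Unset Printing Implicit Defensive.

Import Order.TTheory GRing.Theory Num.Theory.
Local Open Scope ring_scope.

Section Network.
Variables (R : realType) (N : nat).
Implicit Types (W P : 'M[R]_N) (S : {set 'I_N}).

Definition out_weight W (i : 'I_N) : R := \sum_(j < N) W i j.

Definition normalized W : 'M[R]_N :=
  \matrix_(i, j) (if 0 < out_weight W i then W i j / out_weight W i else 0).

(* The rows and columns of a vector or matrix indexed by S are numbered by
   'I_#|S| through [enum_val]. *)
Definition restr P S : 'M[R]_#|S| :=
  \matrix_(i, j) P (enum_val i) (enum_val j).

Definition ones S : 'cV[R]_#|S| := const_mx 1.

Definition dangling W : {set 'I_N} := [set i | out_weight W i == 0].

(* The series may diverge, so it is summed in the extended reals. *)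
Definition walk_weight W (i j : 'I_N) : \bar R :=
  (\sum_(1 <= n <oo) ((W ^+ n) i j)%:E)%E.

Definition recurrent_class W S : Prop :=
  [/\ S != finset.set0,
      S \subset ~: dangling W,
      (forall i j, i \in S -> j \in S -> (0 < walk_weight W i j)%E) &
      (forall i j, i \in S -> j \notin S -> walk_weight W i j = 0%E)].

Definition recurrent_classes W : {set {set 'I_N}} :=
  [set S | `[< recurrent_class W S >]].

Definition transient W : {set 'I_N} :=
  ~: (finset.cover (recurrent_classes W) :|: dangling W).

Definition classification W : {set {set 'I_N}} :=
  recurrent_classes W :|: [set transient W; dangling W].

(* [invmx] leaves a singular matrix unchanged; for W >= 0 and S = transient W
   the matrix I - P_S is invertible. *)
Definition fundamental_row W S : 'rV[R]_#|S| :=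
  (ones S)^T *m invmx (1%:M - restr (normalized W) S).

Definition fundamental_total W S : R :=
  (fundamental_row W S *m ones S) ord0 ord0.

Definition stationary_distribution n (Q : 'M[R]_n) (l : 'rV[R]_n) : Prop :=
  [/\ l *m Q = l, l *m const_mx 1 = 1%:M :> 'M_1 & forall i, 0 <= l ord0 i].

(* The three cases are mutually exclusive for a nonempty S. *)
Definition is_lambda W S (l : 'rV[R]_#|S|) : Prop :=
  [/\ S = dangling W -> l = #|S|%:R^-1 *: (ones S)^T,
      S \in recurrent_classes W ->
        unique (stationary_distribution (restr (normalized W) S)) l &
      S = transient W -> l = (fundamental_total W S)^-1 *: fundamental_row W S].

(* Meant for nonempty S in [classification W]; the last case is then
   S = transient W. *)
Definition beta_star W S : R :=
  if S == dangling W then #|S|%:R^-1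
  else if S \in recurrent_classes W then 0
  else (fundamental_total W S)^-1.

(* A candidate solution is the triple (x^T, delta, beta). *)
Definition feasible W S (z : 'rV[R]_#|S| * R * R) : Prop :=
  let: (xT, delta, beta) := z in
  [/\ xT = (1 - delta) *: (xT *m restr (normalized W) S) + beta *: (ones S)^T,
      xT *m ones S = 1%:M,
      (forall i, 0 <= xT ord0 i),
      0 <= delta <= 1 &
      0 <= beta].

Definition obj_delta S (z : 'rV[R]_#|S| * R * R) : R := z.1.2.
Definition obj_beta S (z : 'rV[R]_#|S| * R * R) : R := z.2.

Definition minimizer (A : Type) (F : A -> Prop) (f : A -> R) (a : A) : Prop :=
  F a /\ forall b, F b -> f a <= f b.

Definition lex_minimizer (A : Type) (F : A -> Prop) (f g : A -> R) : A -> Prop :=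
  minimizer (minimizer F f) g.

End Network.

Arguments obj_delta {R N S} z.
Arguments obj_beta {R N S} z.

(* Main.v *)
(* For delta = 0 the constraints force beta = 0 on a recurrent class, where the
   stationary distribution of an irreducible stochastic matrix is unique, and
   x = beta e^T (I - P_T)^-1 on the transient class.  On the transient class,
   multiplying the constraint for arbitrary delta by v = (I - P_T)^-1 e >= 0 gives
   1 = beta e^T v - delta x^T P_T v <= beta e^T v, so beta is smallest at delta = 0.
   Hence delta = 0 and beta = beta^* are attained together, in either order.
   I - P_T is invertible with nonnegative inverse by a minimum principle: a set
   of transient nodes that no link leaves would contain a recurrent class. *)
Require Import Defs.
From mathcomp Require Import all_boot all_order all_algebra.
From mathcomp Require Import boolp constructive_ereal reals.
From mathcomp Require sequences.

Import Order.TTheory GRing.Theory Num.Theory.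
Local Open Scope ring_scope.

Set Implicit Arguments.
Unset Strict Implicit.
Unset Printing Implicit Defensive.

(** * Stationary vectors of irreducible stochastic matrices *)

(** Irreducibility is expressed below through this notion, as the absence of proper nonempty closed
    sets, which avoids powers of the matrix. *)
Definition closed_support (R : numDomainType) n (Q : 'M[R]_n)
    (B : {set 'I_n}) : Prop :=
  forall i j, i \in B -> 0 < Q i j -> j \in B.

Lemma mulmx_ones_eq1 (R : nzRingType) n (x : 'rV[R]_n) :
  x *m const_mx 1 = 1%:M :> 'M_1 <-> \sum_i x ord0 i = 1.
Proof.
have xE : (x *m const_mx 1 : 'M_1) ord0 ord0 = \sum_i x ord0 i.
  by rewrite mxE; apply: eq_bigr => i _; rewrite mxE mulr1.
split=> [x1|x1]; first by rewrite -xE x1 mxE eqxx.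
by apply/matrixP => i j; rewrite !ord1 xE x1 mxE eqxx.
Qed.

Lemma sum_mulmx_stochastic (R : nzRingType) n (Q : 'M[R]_n) (x : 'rV[R]_n) :
  (forall i, \sum_j Q i j = 1) ->
  \sum_j (x *m Q) ord0 j = \sum_i x ord0 i.
Proof.
move=> Q1; under eq_bigr => j _ do rewrite mxE.
rewrite exchange_big /=; apply: eq_bigr => i _.
by rewrite -mulr_sumr Q1 mulr1.
Qed.

Lemma stationary_norm (R : realDomainType) n (Q : 'M[R]_n) (x : 'rV[R]_n) :
  (forall i j, 0 <= Q i j) -> (forall i, \sum_j Q i j = 1) ->
  x *m Q = x -> map_mx Num.norm x *m Q = map_mx Num.norm x.
Proof.
move=> Q0 Q1 xQ; set y := map_mx _ x.
(* |x| <= |x| Q entrywise by the triangle inequality, and both sides have the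
   same total because Q is stochastic. *)
have le_y j : 0 <= (y *m Q) ord0 j - y ord0 j.
  rewrite subr_ge0 [y _ _]mxE -{1}xQ !mxE (le_trans (ler_norm_sum _ _ _)) //.
  by apply: ler_sum => i _; rewrite normrM (ger0_norm (Q0 _ _)) mxE.
have sum0 : \sum_j ((y *m Q) ord0 j - y ord0 j) = 0.
  by rewrite sumrB sum_mulmx_stochastic // subrr.
apply/rowP => j; apply/eqP; rewrite -subr_eq0; apply/eqP.
exact: (psumr_eq0P (fun j _ => le_y j) sum0).
Qed.

(** A nonnegative fixed row vector passes positive mass along every link out of its support, so the
    support is closed; the zero at [j] rules out full support, which leaves the empty one. *)
Lemma stationary_eq0 (R : realDomainType) n (Q : 'M[R]_n) (y : 'rV[R]_n) (j : 'I_n) :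
  (forall i j, 0 <= Q i j) ->
  (forall B, B != set0 -> closed_support Q B -> B = setT) ->
  y *m Q = y -> (forall i, 0 <= y ord0 i) -> y ord0 j = 0 -> y = 0.
Proof.
move=> Q0 irr yQ y0 yj; pose B := [set i | y ord0 i != 0].
have [B0|B_neq0] := eqVneq B set0.
  apply/rowP => i; rewrite mxE; apply/eqP; apply: negbNE.
  by have := in_set0 i; rewrite -B0 inE => ->.
have /setP/(_ j) : B = setT.
  apply: irr => // i k; rewrite !inE => yi Qik; apply/eqP => yk.
  have s0 : \sum_l y ord0 l * Q l k = 0 by rewrite -[RHS]yk -[in RHS]yQ mxE.
  have := psumr_eq0P (fun l _ => mulr_ge0 (y0 l) (Q0 l k)) s0 isT (i := i).
  by move=> /eqP; rewrite mulf_eq0 (negPf yi) gt_eqF.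
by rewrite !inE yj eqxx.
Qed.

(** [|x| + x] is a nonnegative fixed vector that vanishes wherever [x <= 0], so one such coordinate
    forces [x = -|x|]. Either way [x] has constant sign, and total zero kills it. *)
Lemma irreducible_stationary_unique (R : realFieldType) n (Q : 'M[R]_n) :
  (0 < n)%N -> (forall i j, 0 <= Q i j) -> (forall i, \sum_j Q i j = 1) ->
  (forall B, B != set0 -> closed_support Q B -> B = setT) ->
  forall x : 'rV[R]_n, x *m Q = x -> \sum_i x ord0 i = 0 -> x = 0.
Proof.
move=> n_gt0 Q0 Q1 irr x xQ x0.
have nQ := stationary_norm Q0 Q1 xQ.
have pQ : (map_mx Num.norm x + x) *m Q = map_mx Num.norm x + x.
  by rewrite mulmxDl nQ xQ.
have p0 i : 0 <= (map_mx Num.norm x + x) ord0 i.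
  by rewrite !mxE -lerBlDr sub0r -normrN ler_norm.
have [/existsP[j xj]|] := boolP [exists j, x ord0 j <= 0]; last first.
  rewrite negb_exists => /forallP x_gt0.
  have xp i : 0 <= x ord0 i by rewrite ltW // ltNge x_gt0.
  by have := x_gt0 (Ordinal n_gt0); rewrite (psumr_eq0P (fun i _ => xp i) x0) // lexx.
have p_eq0 : map_mx Num.norm x + x = 0.
  apply: (stationary_eq0 (j := j) Q0 irr pQ p0).
  by rewrite !mxE ler0_norm // addNr.
have xn i : 0 <= - x ord0 i.
  by have /rowP/(_ i) := p_eq0; rewrite !mxE => /eqP; rewrite addr_eq0 => /eqP <-.
have xN0 : \sum_i - x ord0 i = 0 by rewrite sumrN x0 oppr0.
apply/rowP => i; rewrite mxE; apply/eqP; rewrite -oppr_eq0; apply/eqP.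
exact: (psumr_eq0P (fun i _ => xn i) xN0).
Qed.

(** [Q] fixes the column of ones, so [1 - Q] is singular and has a nonzero left kernel vector; its
    absolute value, rescaled to total 1, is the distribution. Two distributions differ by a fixed
    vector of total zero. *)
Lemma irreducible_stationary (R : realType) n (Q : 'M[R]_n) :
  (0 < n)%N -> (forall i j, 0 <= Q i j) -> (forall i, \sum_j Q i j = 1) ->
  (forall B, B != set0 -> closed_support Q B -> B = setT) ->
  exists l, unique (stationary_distribution Q) l.
Proof.
move=> n_gt0 Q0 Q1 irr.
have [x xQ x_neq0] : exists2 x : 'rV[R]_n, x *m Q = x & x != 0.
  have : ~~ row_free (1%:M - Q).
    rewrite row_free_unit; apply/negP => Qu.
    have : (1%:M - Q) *m const_mx 1 = 0 :> 'cV_n.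
      apply/colP => i; rewrite mulmxBl mul1mx !mxE.
      by under eq_bigr => j _ do rewrite mxE mulr1; rewrite Q1 subrr.
    move=> /(congr1 (mulmx (invmx (1%:M - Q)))); rewrite mulKmx // mulmx0.
    by move=> /colP/(_ (Ordinal n_gt0))/eqP; rewrite !mxE oner_eq0.
  rewrite -kermx_eq0 => /rowV0Pn[x /sub_kermxP xQ x0]; exists x => //.
  by apply/esym/eqP; rewrite -subr_eq0 -{1}[x]mulmx1 -mulmxBr xQ.
have yQ := stationary_norm Q0 Q1 xQ; set y := map_mx _ x in yQ.
have y0 i : 0 <= y ord0 i by rewrite mxE.
have s_gt0 : 0 < \sum_i y ord0 i.
  rewrite lt_neqAle sumr_ge0 // andbT eq_sym; apply: contra x_neq0 => /eqP s0.
  apply/eqP/rowP => i; have := psumr_eq0P (fun i _ => y0 i) s0 isT (i := i).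
  by rewrite !mxE => /eqP; rewrite normr_eq0 => /eqP.
exists ((\sum_i y ord0 i)^-1 *: y); split.
  split; first by rewrite -scalemxAl yQ.
    apply/mulmx_ones_eq1; under eq_bigr => i _ do rewrite mxE.
    by rewrite -mulr_sumr mulVf // gt_eqF.
  by move=> i; rewrite mxE mulr_ge0 // invr_ge0 ltW.
move=> l [lQ /mulmx_ones_eq1 l1 _]; apply/eqP; rewrite -subr_eq0; apply/eqP.
apply: (irreducible_stationary_unique n_gt0 Q0 Q1 irr).
  by rewrite mulmxBl -scalemxAl yQ lQ.
under eq_bigr => i _ do rewrite !mxE.
rewrite sumrB l1 -mulr_sumr.
have -> : \sum_i `|x ord0 i| = \sum_i y ord0 i by apply: eq_bigr => i _; rewrite mxE.
by rewrite mulVf ?subrr // gt_eqF.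
Qed.

(** * Substochastic matrices with leaks *)

(* Minimum principle: where v attains a negative minimum, averaging forces the
   whole row mass onto entries with the same value, so the minimizers form a
   closed set from which nothing leaks. *)
Lemma superharmonic_ge0 (R : realDomainType) n (Q : 'M[R]_n) (v : 'cV[R]_n) :
  (forall i j, 0 <= Q i j) -> (forall i, \sum_j Q i j <= 1) ->
  (forall B, B != set0 -> closed_support Q B ->
     exists2 i, i \in B & \sum_j Q i j != 1) ->
  (forall i, (Q *m v) i ord0 <= v i ord0) ->
  forall i, 0 <= v i ord0.
Proof.
move=> Q0 Q1 leak Qv i0; rewrite leNgt; apply/negP => vi0.
have [k _ kmin] := arg_minP (fun i => v i ord0) (isT : xpredT i0).
set m := v k ord0; have m_lt0 : m < 0 by apply: le_lt_trans (kmin i0 isT) vi0.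
have term0 i j : 0 <= Q i j * (v j ord0 - m) by rewrite mulr_ge0 // subr_ge0 kmin.
(* Since [Q v <= v], at a minimizer the averaged gap above [m] is at most [m] times the missing row
   mass. The gap is nonnegative and [m < 0], so no mass is missing and every gap along a link is
   zero. *)
have sumE i : v i ord0 = m -> \sum_j Q i j * (v j ord0 - m) <= m * (1 - \sum_j Q i j).
  move=> vi; under eq_bigr => j _ do rewrite mulrBr.
  rewrite sumrB -mulr_suml mulrBr mulr1 [m * _]mulrC.
  by rewrite lerB // -vi (le_trans _ (Qv i)) // mxE.
have sum_eq i : v i ord0 = m -> \sum_j Q i j = 1.
  move=> vi; apply/eqP; rewrite eq_le Q1 /= -subr_le0 -(ler_nM2l m_lt0) mulr0.
  by apply: le_trans (sumE i vi); apply: sumr_ge0.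
have [||i] := leak [set i | v i ord0 == m].
- by apply/set0Pn; exists k; rewrite inE.
- move=> i j; rewrite !inE => /eqP vi Qij.
  have s0 : \sum_j Q i j * (v j ord0 - m) = 0.
    apply/eqP; rewrite eq_le sumr_ge0 // andbT.
    by have := sumE i vi; rewrite sum_eq // subrr mulr0.
  have /eqP := psumr_eq0P (fun j _ => term0 i j) s0 isT (i := j).
  by rewrite mulf_eq0 gt_eqF //= subr_eq0.
- by rewrite inE => /eqP/sum_eq ->; rewrite eqxx.
Qed.

(** A left kernel vector of the transpose gives a column fixed by [Q]. The minimum principle applies
    to it and to its negative, hence it is zero. *)
Lemma transient_unitmx (R : realFieldType) n (Q : 'M[R]_n) :
  (forall i j, 0 <= Q i j) -> (forall i, \sum_j Q i j <= 1) ->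
  (forall B, B != set0 -> closed_support Q B ->
     exists2 i, i \in B & \sum_j Q i j != 1) ->
  1%:M - Q \in unitmx.
Proof.
move=> Q0 Q1 leak; rewrite -unitmx_tr -row_free_unit -kermx_eq0; apply/negPn/negP.
move=> /rowV0Pn[x /sub_kermxP xQ]; apply/negP; rewrite negbK; apply/eqP.
have Qx : Q *m x^T = x^T.
  apply/esym/eqP; rewrite -subr_eq0 -{1}[x^T]mul1mx -mulmxBl.
  by rewrite -[1%:M - Q]trmxK -trmx_mul xQ trmx0.
apply/rowP => i; rewrite mxE; apply/eqP; rewrite eq_le -oppr_ge0; apply/andP; split.
  have := superharmonic_ge0 (v := - x^T) Q0 Q1 leak; rewrite mulmxN Qx.
  by move=> /(_ _ i); rewrite !mxE; apply.
have := superharmonic_ge0 (v := x^T) Q0 Q1 leak; rewrite Qx.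
by move=> /(_ _ i); rewrite !mxE; apply.
Qed.

(** Each column [c] of the inverse satisfies [c - Q c >= 0], the difference being a basis vector, so
    the minimum principle applies to it. *)
Lemma transient_invmx_ge0 (R : realFieldType) n (Q : 'M[R]_n) :
  (forall i j, 0 <= Q i j) -> (forall i, \sum_j Q i j <= 1) ->
  (forall B, B != set0 -> closed_support Q B ->
     exists2 i, i \in B & \sum_j Q i j != 1) ->
  forall i j, 0 <= invmx (1%:M - Q) i j.
Proof.
move=> Q0 Q1 leak i j; have Qu := transient_unitmx Q0 Q1 leak.
pose c := col j (invmx (1%:M - Q)).
have cE : c - Q *m c = col j 1%:M.
  by rewrite -{1}[c]mul1mx -mulmxBl /c colE mulmxA mulmxV // mul1mx colE mul1mx.
have -> : invmx (1%:M - Q) i j = c i ord0 by rewrite mxE.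
apply: (superharmonic_ge0 Q0 Q1 leak) => k.
by rewrite -subr_ge0; have /colP/(_ k) := cE; rewrite !mxE => ->; rewrite ler0n.
Qed.

(** * Walks, closed sets and recurrent classes *)

Lemma expmx_ge0 (R : realDomainType) N (W : 'M[R]_N) n :
  (forall i j, 0 <= W i j) -> forall i j, 0 <= (W ^+ n) i j.
Proof.
move=> W0; elim: n => [|n IHn] i j; first by rewrite expr0 mxE ler0n.
by rewrite exprS mxE sumr_ge0 // => k _; rewrite mulr_ge0.
Qed.

Lemma expmx_closed_support (R : realDomainType) N (W : 'M[R]_N) (C : {set 'I_N}) n :
  (forall i j, 0 <= W i j) -> closed_support W C ->
  forall i j, i \in C -> j \notin C -> (W ^+ n) i j = 0.
Proof.
move=> W0 Ccl; elim: n => [|n IHn] i j iC jC.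
  by rewrite expr0 mxE; case: eqP => // ij; rewrite -ij iC in jC.
rewrite exprS mxE big1 // => k _; have [Wik|] := boolP (0 < W i k).
  by rewrite IHn ?mulr0 //; apply: Ccl Wik.
by rewrite lt_def W0 andbT negbK => /eqP ->; rewrite mul0r.
Qed.

Lemma walk_weight_ge (R : realType) N (W : 'M[R]_N) i j n :
  (forall i j, 0 <= W i j) -> (((W ^+ n.+1) i j)%:E <= walk_weight W i j)%E.
Proof.
move=> W0.
have t0 k : (1 <= k)%N -> true -> (0 <= ((W ^+ k) i j)%:E)%E.
  by move=> _ _; rewrite lee_fin expmx_ge0.
(* The upper bound is exclusive, so [n.+2] makes the power [n.+1] the last summand. *)
apply: le_trans (sequences.nneseries_lim_ge n.+2 t0).
rewrite big_nat_recr //= -[leLHS]add0e; apply: leeD => //.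
by apply: sume_ge0 => k _; rewrite lee_fin expmx_ge0.
Qed.

Lemma walk_weight_eq0 (R : realType) N (W : 'M[R]_N) i j :
  (forall n, (W ^+ n.+1) i j = 0) -> walk_weight W i j = 0%E.
Proof. by move=> W0; apply: sequences.eseries0 => -[//|n] _ _; rewrite W0. Qed.

Lemma walk_weight_gt0 (R : realType) N (W : 'M[R]_N) i j :
  (forall i j, 0 <= W i j) ->
  (0 < walk_weight W i j)%E <-> exists n, 0 < (W ^+ n.+1) i j.
Proof.
move=> W0; split=> [w_gt0|[n Wn]]; last first.
  by apply: lt_le_trans (walk_weight_ge i j n W0); rewrite lte_fin.
apply: contrapT => noW; move: w_gt0; rewrite walk_weight_eq0 ?ltxx // => n.
apply/eqP; rewrite eq_le expmx_ge0 // andbT leNgt; apply/negP => Wn.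
by apply: noW; exists n.
Qed.

Lemma walk_weight_closed_support (R : realType) N (W : 'M[R]_N) (C : {set 'I_N}) :
  (forall i j, 0 <= W i j) -> closed_support W C ->
  forall i j, i \in C -> j \notin C -> walk_weight W i j = 0%E.
Proof.
move=> W0 Ccl i j iC jC; apply: walk_weight_eq0 => n.
exact: (expmx_closed_support _ W0 Ccl).
Qed.

Lemma recurrent_class_closed (R : realType) N (W : 'M[R]_N) (S : {set 'I_N}) :
  (forall i j, 0 <= W i j) -> recurrent_class W S -> closed_support W S.
Proof.
move=> W0 [_ _ _ out0] i j iS Wij; apply: contraT => jS.
have := walk_weight_ge i j 0 W0.
by rewrite (out0 i j iS jS) expr1 lee_fin leNgt Wij.
Qed.

(** Walks from a member of a closed [C] stay in [C], yet strong connectivity makes them reach all of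
    [S]. This is the network form of irreducibility. *)
Lemma recurrent_class_minimal (R : realType) N (W : 'M[R]_N) (S : {set 'I_N}) C :
  (forall i j, 0 <= W i j) -> recurrent_class W S ->
  C != set0 -> C \subset S -> closed_support W C -> C = S.
Proof.
move=> W0 [_ _ conn _] /set0Pn[i iC] CS Ccl; apply/eqP; rewrite eqEsubset CS /=.
apply/subsetP => j jS; apply: contraT => jC.
have := conn i j (subsetP CS i iC) jS.
by rewrite (walk_weight_closed_support W0 Ccl) // ltxx.
Qed.

Lemma dangling_link (R : realType) N (W : 'M[R]_N) i :
  (forall i j, 0 <= W i j) -> i \notin dangling W -> exists j, 0 < W i j.
Proof.
move=> W0; rewrite inE => iD; apply/existsP; apply: contraT.
rewrite negb_exists => /forallP Wi; case/negP: iD; apply/eqP.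
rewrite /out_weight big1 // => j _.
by apply/eqP; rewrite eq_le W0 andbT leNgt Wi.
Qed.

(* A minimal nonempty closed set is a recurrent class: the nodes reachable from
   any of its members form a closed subset of it. *)
Lemma closed_support_recurrent_class (R : realType) N (W : 'M[R]_N) (C : {set 'I_N}) :
  (forall i j, 0 <= W i j) -> C != set0 -> C \subset ~: dangling W ->
  closed_support W C -> exists2 S, recurrent_class W S & S \subset C.
Proof.
move=> W0 C0 CD Ccl.
pose p A := (A != set0) && `[< closed_support W A >].
have pC : p C by rewrite /p C0; apply/asboolP.
have [S Smin SC] := minset_exists pC; exists S => //.
have /andP[S0 /asboolP Scl] := minsetp Smin.
have SD := subset_trans SC CD.
split=> // [i j iS jS|]; last exact: walk_weight_closed_support.
pose B := [set k | `[< (0 < walk_weight W i k)%E >]].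
suff SB : S = B by move: jS; rewrite SB inE => /asboolP.
apply/esym; apply: (minsetinf Smin).
  apply/andP; split.
    (* Walk weights start at length one, so [i] is not in [B] by default; nonemptiness comes from a
       link out of the non-dangling node [i]. *)
    have iD : i \notin dangling W by have := subsetP SD i iS; rewrite in_setC.
    have [k Wik] := dangling_link W0 iD.
    apply/set0Pn; exists k; rewrite inE; apply/asboolP/walk_weight_gt0 => //.
    by exists 0; rewrite expr1.
  apply/asboolP => k l; rewrite !inE => /asboolP/(walk_weight_gt0 _ _ W0)[n Wn] Wkl.
  apply/asboolP; apply/(walk_weight_gt0 _ _ W0); exists n.+1.
  rewrite exprSr mxE (bigD1 k) //= ltr_pwDl ?mulr_gt0 //.
  by apply: sumr_ge0 => m _; rewrite mulr_ge0 ?expmx_ge0.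
apply/subsetP => k; rewrite inE => /asboolP w_gt0; apply: contraT => kS.
by rewrite (walk_weight_closed_support W0 Scl) ?ltxx in w_gt0.
Qed.

(** * The normalized matrix restricted to a class *)

Lemma out_weight_ge0 (R : realType) N (W : 'M[R]_N) i :
  (forall i j, 0 <= W i j) -> 0 <= out_weight W i.
Proof. by move=> W0; apply: sumr_ge0. Qed.

Lemma normalized_ge0 (R : realType) N (W : 'M[R]_N) i j :
  (forall i j, 0 <= W i j) -> 0 <= normalized W i j.
Proof. by move=> W0; rewrite mxE; case: ifP => // w; rewrite divr_ge0 // ltW. Qed.

(** Transfers closedness between [W] and the normalized matrix. In the zero-row case [W i j] is
    bounded by the out-weight, which is at most 0. *)
Lemma normalized_gt0 (R : realType) N (W : 'M[R]_N) i j :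
  (forall i j, 0 <= W i j) -> (0 < normalized W i j) = (0 < W i j).
Proof.
move=> W0; rewrite mxE; case: ifP => [w|]; first by rewrite pmulr_lgt0 ?invr_gt0.
move=> /negbT; rewrite -leNgt ltxx => w; apply/esym/negbTE; rewrite -leNgt.
by apply: le_trans w; rewrite /out_weight (bigD1 j) //= lerDl sumr_ge0.
Qed.

Lemma normalized_sum (R : realType) N (W : 'M[R]_N) i :
  (forall i j, 0 <= W i j) -> i \notin dangling W -> \sum_j normalized W i j = 1.
Proof.
move=> W0; rewrite inE => iD.
have w : 0 < out_weight W i by rewrite lt_def iD out_weight_ge0.
by under eq_bigr => j _ do rewrite mxE w; rewrite -mulr_suml divff.
Qed.

Lemma restr_sum (R : realType) N (P : 'M[R]_N) (S : {set 'I_N}) (i : 'I_#|S|) :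
  \sum_j restr P S i j = \sum_(j in S) P (enum_val i) j.
Proof. by rewrite [RHS]big_enum_val; apply: eq_bigr => j _; rewrite mxE. Qed.

Lemma restr_normalized_dangling (R : realType) N (W : 'M[R]_N) :
  restr (normalized W) (dangling W) = 0.
Proof.
apply/matrixP => i j; rewrite !mxE.
by have := enum_valP i; rewrite inE => /eqP ->; rewrite ltxx.
Qed.

Lemma recurrent_restr_sum (R : realType) N (W : 'M[R]_N) (S : {set 'I_N}) :
  (forall i j, 0 <= W i j) -> recurrent_class W S ->
  forall i, \sum_j restr (normalized W) S i j = 1.
Proof.
move=> W0 Srec i; have [_ SD _ _] := Srec; have iS := enum_valP i.
have iD : enum_val i \notin dangling W by have := subsetP SD _ iS; rewrite in_setC.
rewrite restr_sum -(normalized_sum W0 iD) big_mkcond; apply: eq_bigr => j _.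
case: ifPn => // jS; apply/esym/eqP; rewrite eq_le normalized_ge0 // andbT.
rewrite leNgt normalized_gt0 //; apply: contra jS.
exact: recurrent_class_closed.
Qed.

(** Because no link leaves [S], a closed set of indices maps under [enum_val] to a closed set of the
    whole network, and minimality of [S] applies. *)
Lemma recurrent_restr_irreducible (R : realType) N (W : 'M[R]_N) (S : {set 'I_N}) :
  (forall i j, 0 <= W i j) -> recurrent_class W S ->
  forall B, B != set0 -> closed_support (restr (normalized W) S) B -> B = setT.
Proof.
move=> W0 Srec B B0 Bcl.
have SE : enum_val @: B = S.
  apply: (recurrent_class_minimal W0 Srec); first by rewrite imset_eq0.
    by apply/subsetP => _ /imsetP[k _ ->]; apply: enum_valP.
  move=> _ j /imsetP[i iB ->] Wij.
  have jS := recurrent_class_closed W0 Srec (enum_valP i) Wij.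
  apply/imsetP; exists (enum_rank_in jS j); last by rewrite enum_rankK_in.
  by apply: Bcl iB _; rewrite mxE enum_rankK_in // normalized_gt0.
apply/setP => k; rewrite inE.
have /imsetP[l lB /enum_val_inj ->] : enum_val k \in enum_val @: B
  by rewrite SE enum_valP.
by [].
Qed.

Lemma transientP (R : realType) N (W : 'M[R]_N) i :
  i \in transient W -> i \notin dangling W /\ forall S, recurrent_class W S -> i \notin S.
Proof.
rewrite in_setC in_setU negb_or => /andP[iR iD]; split=> // S Srec.
apply: contra iR => iS; apply/bigcupP; exists S => //.
by rewrite inE; apply/asboolP.
Qed.

Lemma transient_restr_sum (R : realType) N (W : 'M[R]_N) :
  (forall i j, 0 <= W i j) ->
  forall i, \sum_j restr (normalized W) (transient W) i j <= 1.
Proof.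
move=> W0 i; have [iD _] := transientP (enum_valP i).
rewrite restr_sum -(normalized_sum W0 iD) big_mkcond.
by apply: ler_sum => j _; case: ifP => // _; apply: normalized_ge0.
Qed.

(** If every row of [B] had full mass inside the transient class, no link of the whole network would
    leave [B]. It would then contain a recurrent class, while transient nodes lie in none. *)
Lemma transient_restr_leak (R : realType) N (W : 'M[R]_N) :
  (forall i j, 0 <= W i j) ->
  forall B, B != set0 -> closed_support (restr (normalized W) (transient W)) B ->
  exists2 i, i \in B & \sum_j restr (normalized W) (transient W) i j != 1.
Proof.
move=> W0 B B0 Bcl; apply/exists_inP; apply: contraT.
rewrite negb_exists_in => /forall_inP sum1.
have BT : enum_val @: B \subset transient W.
  by apply/subsetP => _ /imsetP[k _ ->]; apply: enum_valP.
have [||_ j /imsetP[i iB ->] Wij|S Srec SB] :=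
  @closed_support_recurrent_class _ _ W (enum_val @: B) W0.
- by rewrite imset_eq0.
- by apply/subsetP => k /(subsetP BT)/transientP[kD _]; rewrite in_setC.
- have [iD _] := transientP (enum_valP i).
  have jT : j \in transient W.
    apply: contraT => jT; have := sum1 i iB; rewrite negbK restr_sum => /eqP Q1.
    have := normalized_sum W0 iD; rewrite (bigID (mem (transient W))) /= Q1.
    move=> /(canRL (addKr _)); rewrite addNr => s0.
    have := psumr_eq0P (fun j _ => normalized_ge0 (enum_val i) j W0) s0 jT.
    by move=> /eqP; rewrite gt_eqF // normalized_gt0.
  apply/imsetP; exists (enum_rank_in jT j); last by rewrite enum_rankK_in.
  by apply: Bcl iB _; rewrite mxE enum_rankK_in // normalized_gt0.
have [/set0Pn[k kS] _ _ _] := Srec.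
by have [_ /(_ S Srec)] := transientP (subsetP BT k (subsetP SB k kS)); rewrite kS.
Qed.

(** * Lexicographic minimizers *)

Lemma lex_minimizer_unique (R : realType) A (F : A -> Prop) (f g : A -> R) a :
  F a -> (forall b, F b -> f a <= f b) ->
  (forall b, F b -> f b = f a -> g a <= g b) ->
  (forall b, F b -> f b = f a -> g b = g a -> b = a) ->
  forall b, lex_minimizer F f g b <-> b = a.
Proof.
move=> Fa fa ga uniq_a b.
have mina : minimizer F f a by [].
have fE c : minimizer F f c -> f c = f a.
  by case=> Fc fc; apply/eqP; rewrite eq_le fc // fa.
split=> [[bmin gb]|->].
  have [Fb _] := bmin; apply: uniq_a => //; first exact: fE.
  by apply/eqP; rewrite eq_le gb // ga // fE.
by split=> // c cmin; apply: ga; [case: cmin|apply: fE].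
Qed.

(** The lower bounds [0] and [b] are attained together, so neither order trades one objective
    against the other. Both orders end at [delta = 0], where the triple is determined. *)
Lemma lex_minimizers (R : realType) N (W : 'M[R]_N) (S : {set 'I_N})
    (l : 'rV[R]_#|S|) b :
  feasible W (S := S) (l, 0, b) ->
  (forall z, feasible W (S := S) z -> b <= z.2) ->
  (forall x c, feasible W (S := S) (x, 0, c) -> (x, c) = (l, b)) ->
  (forall z, lex_minimizer (feasible W (S := S)) obj_delta obj_beta z
     <-> z = (l, 0, b)) /\
  (forall z, lex_minimizer (feasible W (S := S)) obj_beta obj_delta z
     <-> z = (l, 0, b)).
Proof.
move=> Fl bmin uniq0.
have dmin z : feasible W (S := S) z -> 0 <= z.1.2 :> R.
    by case: z => -[x d] c [_ _ _ /andP[]].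
have z_uniq z : feasible W (S := S) z -> z.1.2 = 0 -> z = (l, 0, b).
  by case: z => -[x d] c Fz /= d0; move: Fz; rewrite d0 => /uniq0[-> ->].
by split; apply: lex_minimizer_unique => //= z Fz; rewrite /obj_delta /obj_beta /=;
  auto.
Qed.

(** * The optimum on each kind of class *)

Lemma ones_trmx_mul (R : realType) N (S : {set 'I_N}) :
  (ones R S)^T *m ones R S = #|S|%:R%:M.
Proof.
apply/matrixP => i j; rewrite !ord1 !mxE eqxx.
under eq_bigr => k _ do rewrite !mxE mulr1.
by rewrite sumr_const card_ord.
Qed.

Lemma scalar_mx11_inj (R : nzRingType) (a b : R) : a%:M = b%:M :> 'M_1 -> a = b.
Proof. by move=> /matrixP/(_ ord0 ord0); rewrite !mxE eqxx. Qed.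

(** Since [P_D = 0], the constraint reads [x = c e^T] whatever [delta] is, and total mass 1 then
    fixes [c]. *)
Lemma dangling_optimum (R : realType) N (W : 'M[R]_N) :
  let D := dangling W in let n : R := #|D|%:R in D != set0 ->
  [/\ feasible W (S := D) (n^-1 *: (ones R D)^T, 0, n^-1),
      (forall z : 'rV[R]_#|D| * R * R, feasible W (S := D) z -> n^-1 <= z.2) &
      (forall x c, feasible W (S := D) (x, 0, c) ->
         (x, c) = (n^-1 *: (ones R D)^T, n^-1))].
Proof.
move=> D n D0.
have n_gt0 : 0 < n by rewrite ltr0n card_gt0.
have n_neq0 : n != 0 by rewrite gt_eqF.
have sol x d c : feasible W (S := D) (x, d, c) -> x = c *: (ones R D)^T /\ c = n^-1.
  case=> xE x1 _ _ _; rewrite restr_normalized_dangling mulmx0 scaler0 add0r in xE.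
  split=> //; apply: (mulIf n_neq0); rewrite mulVf //; apply: scalar_mx11_inj.
  by rewrite -x1 xE -scalemxAl ones_trmx_mul scale_scalar_mx.
split=> [|[[x d] c] /sol[_ ->] //|x c /sol[-> ->] //].
split; rewrite ?lexx ?ler01 ?invr_ge0 ?ltW //.
- by rewrite restr_normalized_dangling mulmx0 scaler0 add0r.
- by rewrite -scalemxAl ones_trmx_mul scale_scalar_mx mulVf.
- by move=> i; rewrite !mxE mulr1 invr_ge0 ltW.
Qed.

Lemma recurrent_optimum (R : realType) N (W : 'M[R]_N) (S : {set 'I_N})
    (l : 'rV[R]_#|S|) :
  (forall i j, 0 <= W i j) -> recurrent_class W S ->
  unique (stationary_distribution (restr (normalized W) S)) l ->
  [/\ feasible W (S := S) (l, 0, 0),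
      (forall z : 'rV[R]_#|S| * R * R, feasible W (S := S) z -> 0 <= z.2) &
      (forall x c, feasible W (S := S) (x, 0, c) -> (x, c) = (l, 0))].
Proof.
move=> W0 Srec [[lQ l1 l0] l_uniq]; have [S0 _ _ _] := Srec.
split=> [|[[x d] c] []//|x c].
  by split; rewrite ?lexx ?ler01 // subr0 scale1r lQ scale0r addr0.
case=> xE x1 x0 _ _; rewrite subr0 scale1r in xE.
have Q1 : restr (normalized W) S *m ones R S = ones R S.
  apply/colP => i; rewrite !mxE -[RHS](recurrent_restr_sum W0 Srec i).
  by apply: eq_bigr => j _; rewrite [ones _ _ _ _]mxE mulr1.
(* Multiplying the constraint by the ones column, which [P_S] fixes, cancels the mass of [x] and
   leaves [c * #|S| = 0]. *)
have c0 : c = 0.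
  have := congr1 (mulmx^~ (ones R S)) xE.
  rewrite /= mulmxDl -mulmxA Q1 -[X in X = _]addr0 => /addrI/esym/eqP.
  rewrite -scalemxAl ones_trmx_mul scale_scalar_mx -(raddf0 (@scalar_mx R 1)).
  move=> /eqP/scalar_mx11_inj/eqP.
  by rewrite mulf_eq0 pnatr_eq0 cards_eq0 (negPf S0) orbF => /eqP.
have <- // : l = x; last by rewrite c0.
by apply: l_uniq; split=> //; rewrite {2}xE c0 scale0r addr0.
Qed.

Lemma transient_optimum (R : realType) N (W : 'M[R]_N) :
  (forall i j, 0 <= W i j) ->
  let T := transient W in let tau := fundamental_total W T in T != set0 ->
  [/\ feasible W (S := T) (tau^-1 *: fundamental_row W T, 0, tau^-1),
      (forall z : 'rV[R]_#|T| * R * R, feasible W (S := T) z -> tau^-1 <= z.2) &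
      (forall x c, feasible W (S := T) (x, 0, c) ->
         (x, c) = (tau^-1 *: fundamental_row W T, tau^-1))].
Proof.
move=> W0 T tau T0; pose Q := restr (normalized W) T.
have Q0 i j : 0 <= Q i j by rewrite mxE normalized_ge0.
have Qu : 1%:M - Q \in unitmx.
  exact: transient_unitmx Q0 (transient_restr_sum W0) (transient_restr_leak W0).
have inv0 : forall i j, 0 <= invmx (1%:M - Q) i j.
  exact: transient_invmx_ge0 Q0 (transient_restr_sum W0) (transient_restr_leak W0).
have FQ : fundamental_row W T *m (1%:M - Q) = (ones R T)^T by rewrite mulmxKV.
have F0 i : 0 <= fundamental_row W T ord0 i.
  by rewrite mxE sumr_ge0 // => j _; rewrite !mxE mul1r; apply: inv0.
have tauE : fundamental_row W T *m ones R T = tau%:M.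
  by apply/matrixP => i j; rewrite !ord1 [RHS]mxE eqxx.
have tau_sum : tau = \sum_i fundamental_row W T ord0 i.
  rewrite /tau /fundamental_total mxE; apply: eq_bigr => i _.
  by rewrite [ones _ _ _ _]mxE mulr1.
(* If [tau] were 0, the nonnegative row would vanish, but its product with [1 - Q] is the ones row
   of a nonempty class. *)
have tau_gt0 : 0 < tau.
  rewrite lt_def tau_sum sumr_ge0 // andbT; apply/eqP => s0.
  have F_eq0 : fundamental_row W T = 0.
    by apply/rowP => i; rewrite (psumr_eq0P (fun i _ => F0 i) s0) // mxE.
  have /set0Pn[i iT] := T0; have /rowP/(_ (enum_rank_in iT i)) := FQ.
  by rewrite F_eq0 mul0mx !mxE => /esym/eqP; rewrite oner_eq0.
have tau_neq0 : tau != 0 by rewrite gt_eqF.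
split.
- split; rewrite ?lexx ?ler01 ?invr_ge0 ?ltW //.
  + rewrite subr0 scale1r -scalemxAl -scalerDr; congr (_ *: _).
    by rewrite -FQ mulmxBr mulmx1 addrC subrK.
  + by rewrite -scalemxAl tauE scale_scalar_mx mulVf.
  + by move=> i; rewrite mxE mulr_ge0 // invr_ge0 ltW.
- move=> [[x d] c] [xE x1 x0 /andP[d0 _] _] /=.
  pose v := invmx (1%:M - Q) *m ones R T.
  have v0 i : 0 <= v i ord0.
    by rewrite mxE sumr_ge0 // => j _; rewrite [ones _ _ _ _]mxE mulr1 inv0.
  have xQv0 : 0 <= (x *m Q *m v) ord0 ord0.
    rewrite mxE sumr_ge0 // => i _; rewrite mulr_ge0 // mxE.
    by rewrite sumr_ge0 // => j _; rewrite mulr_ge0.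
  have xB : x *m (1%:M - Q) = c *: (ones R T)^T - d *: (x *m Q).
    rewrite mulmxBr mulmx1 {1}xE scalerBl scale1r -/T -/Q.
    by rewrite addrAC [_ *m _ - _]addrC addrK addrC.
  (* Multiplying [xB] by [v] turns its left side into the total mass 1 and the ones row into [tau];
     the [delta] term is nonnegative, so [1 <= c * tau]. *)
  have : 1%:M = (c * tau)%:M - d *: (x *m Q *m v) :> 'M_1.
    have Fv : (ones R T)^T *m v = tau%:M by rewrite mulmxA.
    have xv : x *m ones R T = x *m (1%:M - Q) *m v by rewrite mulmxA mulmxK.
    by rewrite -x1 xv xB mulmxBl -!scalemxAl Fv scale_scalar_mx.
  move=> /matrixP/(_ ord0 ord0); rewrite !mxE eqxx !mulr1n => ctau.
  rewrite mxE in xQv0.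
  by rewrite -[tau^-1]mul1r ler_pdivrMr // ctau lerBlDr lerDl mulr_ge0.
- move=> x c [xE x1 _ _ _]; rewrite subr0 scale1r in xE.
  have xF : x = c *: fundamental_row W T.
    rewrite -[LHS](mulmxK Qu) mulmxBr mulmx1 {1}xE addrAC subrr add0r.
    by rewrite -scalemxAl.
  have cE : c = tau^-1.
    apply: (mulIf tau_neq0); rewrite mulVf //; apply: scalar_mx11_inj.
    by rewrite -x1 xF -scalemxAl tauE scale_scalar_mx.
  by rewrite xF cE.
Qed.

(** * Case analysis over the classification *)

Theorem theorem2p7 (R : realType) (N : nat) (W : 'M[R]_N)
    (W_ge0 : forall i j : 'I_N, 0 <= W i j)
    (S : {set 'I_N}) (S_class : S \in classification W) (S_neq0 : S != set0) :
  exists lambda : 'rV[R]_#|S|,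
    [/\ is_lambda W lambda,
        (forall z : 'rV[R]_#|S| * R * R,
           lex_minimizer (feasible W (S := S)) obj_delta obj_beta z
           <-> z = (lambda, 0, beta_star W S)) &
        (forall z : 'rV[R]_#|S| * R * R,
           lex_minimizer (feasible W (S := S)) obj_beta obj_delta z
           <-> z = (lambda, 0, beta_star W S))].
Proof.
suff [l [Sl [Fl bmin uniq0]]] : exists l : 'rV[R]_#|S|, is_lambda W l /\
    [/\ feasible W (S := S) (l, 0, beta_star W S),
        (forall z : 'rV[R]_#|S| * R * R, feasible W (S := S) z -> beta_star W S <= z.2) &
        (forall x c, feasible W (S := S) (x, 0, c) -> (x, c) = (l, beta_star W S))].
  by exists l; have [] := lex_minimizers Fl bmin uniq0.
have recP A : A \in recurrent_classes W -> recurrent_class W A.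
  by rewrite inE => /asboolP.
(* A nonempty class is of one kind only, so in each case the other clauses of [is_lambda] are
   vacuous and [beta_star] takes the intended branch. *)
have rec_disj : S \in recurrent_classes W -> S != dangling W /\ S != transient W.
  move=> /recP Srec; have [/set0Pn[i iS] SD _ _] := Srec; have := subsetP SD i iS.
  rewrite in_setC => iD; split; apply/eqP => SE; first by rewrite -SE iS in iD.
  have iT : i \in transient W by rewrite -SE.
  by have [_ /(_ S Srec)] := transientP iT; rewrite iS.
have transient_neq : S = transient W -> S != dangling W.
  move=> ST; have /set0Pn[i iS] := S_neq0; apply/eqP => SD.
  have iT : i \in transient W by rewrite -ST.
  by have [] := transientP iT; rewrite -SD iS.
rewrite /beta_star; have [SD|SD] := eqVneq S (dangling W).
  exists (#|S|%:R^-1 *: (ones R S)^T); split.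
    by split=> // [/rec_disj[]|/transient_neq]; rewrite SD eqxx.
  by subst S; apply: dangling_optimum.
have [Srec|Srec] := boolP (S \in recurrent_classes W).
  have [_ ST] := rec_disj Srec; have S_rec := recP _ Srec.
  have S_gt0 : (0 < #|S|)%N by rewrite card_gt0.
  have Q0 i j : 0 <= restr (normalized W) S i j by rewrite mxE normalized_ge0.
  have [l l_uniq] := irreducible_stationary S_gt0 Q0
    (recurrent_restr_sum W_ge0 S_rec) (recurrent_restr_irreducible W_ge0 S_rec).
  exists l; split; last exact: recurrent_optimum.
  by split=> // SE; [rewrite SE eqxx in SD|rewrite SE eqxx in ST].
have ST : S = transient W.
  by move: S_class; rewrite in_setU in_set2 (negPf Srec) (negPf SD) orbF => /eqP.
exists ((fundamental_total W S)^-1 *: fundamental_row W S); split.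
  by split=> // [SE|Srec']; [rewrite SE eqxx in SD|rewrite Srec' in Srec].
by subst S; apply: transient_optimum.
Qed.
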